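(* Let $\mathcal{D}$ be the set of partitions into distinct parts and $\mathcal{U}$ the set of all partitions. As formal power series in $q$, $$\sum_{\pi\in\mathcal{D}} \widetilde{\omega}_2(\pi)\, q^{|\pi|} = \sum_{\pi\in\mathcal{U}} \omega_2'(\pi)\, q^{|\pi|},$$ where, for $\pi=(\lambda_1,\lambda_2,\dots,\lambda_{\nu(\pi)})$ and with the convention $\lambda_{\nu(\pi)+1}:=0$, $$\widetilde{\omega}_2(\pi)=\prod_{i=1}^{\nu(\pi)}(2\lambda_i-2\lambda_{i+1}-1),$$ and $$\omega_2'(\pi)=2^{\nu_{de}(\pi)}\left(1+\sum_{i\geq 0}\chi\big((4i+3)\in\pi\big)\,2^{\mu_{4i+3,o}(\pi)}\right).$$
   Context: A partition $\pi=(\lambda_1,\lambda_2,\dots,\lambda_{\nu(\pi)})$ is a finite non-increasing sequence of positive integers (its parts); $\nu(\pi)$ is the number of parts and $|\pi|$ is the sum of the parts. The empty sequence is the unique partition of $0$, and it belongs to both $\mathcal{D}$ and $\mathcal{U}$. Empty products equal $1$. $\nu_{de}(\pi)$ is the number of different even parts of $\pi$ (not counting repetitions). For an integer $n$, $\mu_{n,o}(\pi)$ is the number of different odd parts of $\pi$ (not counting repetitions) that are $\geq n$. $\chi(\text{statement})$ equals $1$ if the statement is true and $0$ otherwise; $(4i+3)\in\pi$ means that $4i+3$ is a part of $\pi$. *)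

(* Defs.v *)
From HB Require Import structures.
From mathcomp Require Import all_boot all_order all_algebra.
From mathcomp Require Import zify.

Set Implicit Arguments.
Unset Strict Implicit.
Unset Printing Implicit Defensive.

Import Order.TTheory GRing.Theory Num.Theory.
Local Open Scope ring_scope.

(* A partition is the non-increasing sequence of its (positive) parts;
   |pi| is [sumn pi] and nu(pi) is [size pi]. *)
Definition partU : pred (seq nat) := fun s => sorted geq s && (0%N \notin s).

Definition partD : pred (seq nat) := fun s => partU s && uniq s.

(* A partition of n has at most n parts, each at most n, so that bounded
   sequences over 'I_n.+1 capture all of them; see [mem_partitions_of]. *)
Definition partitions_of (n : nat) : seq (seq nat) :=
  [seq s <- [seq map val (b : seq 'I_n.+1) | b : n.-bseq 'I_n.+1]
     | partU s && (sumn s == n)].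

Lemma partitions_of_uniq n : uniq (partitions_of n).
Proof.
apply: filter_uniq; rewrite map_inj_uniq ?enum_uniq // => b c /inj_map.
by move=> /(_ val_inj) /val_inj.
Qed.

Lemma mem_partitions_of n s :
  (s \in partitions_of n) = partU s && (sumn s == n).
Proof.
rewrite mem_filter andb_idr // => /andP[/andP[_ s0] /eqP sn].
have le_sz : (size s <= n)%N.
  rewrite -sn; elim: s s0 {sn} => //= x s IHs.
  by rewrite inE negb_or => /andP[x0 /IHs]; case: x x0 => // x _; lia.
have le_n : all (fun x => x < n.+1)%N s.
  apply/allP => x; rewrite -sn ltnS; elim: s {s0 sn le_sz} => //= y s IHs.
  by rewrite inE => /orP[/eqP->|/IHs]; lia.
have vs : map val (map (inord : nat -> 'I_n.+1) s) = s.
  rewrite -map_comp -[RHS]map_id; apply/eq_in_map => x /(allP le_n) /= ?.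
  by rewrite inordK.
have sz : (size (map (inord : nat -> 'I_n.+1) s) <= n)%N by rewrite size_map.
by apply/mapP; exists (Bseq sz); rewrite ?mem_enum.
Qed.

(* The formal power series \sum_(pi in A) w(pi) q^|pi| over int, as the
   sequence of its coefficients. *)
Definition gen_series (A : pred (seq nat)) (w : seq nat -> int) : nat -> int :=
  fun n => \sum_(pi <- partitions_of n | A pi) w pi.

(* [nth 0 pi i] is lambda_{i+1}, and 0 past the last part, which is the
   convention lambda_{nu(pi)+1} = 0. *)
Definition omega2_tilde (pi : seq nat) : int :=
  \prod_(0 <= i < size pi)
     (2 * (nth 0%N pi i)%:Z - 2 * (nth 0%N pi i.+1)%:Z - 1).

Definition nu_de (pi : seq nat) : nat :=
  count (fun x => ~~ odd x) (undup pi).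

Definition mu_o (n : nat) (pi : seq nat) : nat :=
  count (fun x => odd x && (n <= x)%N) (undup pi).

(* The sum over all i >= 0 is cut at i < |pi|: beyond it 4i+3 is larger than
   any part. The bound is immaterial, see [omega2_primeE]. *)
Definition omega2_prime (pi : seq nat) : int :=
  2 ^+ nu_de pi *
  (1 + \sum_(0 <= i < sumn pi)
         ((4 * i + 3)%N \in pi)%:R * 2 ^+ mu_o (4 * i + 3)%N pi).

Lemma omega2_primeE (pi : seq nat) (N : nat) : (sumn pi <= N)%N ->
  omega2_prime pi =
  2 ^+ nu_de pi *
  (1 + \sum_(0 <= i < N)
         ((4 * i + 3)%N \in pi)%:R * 2 ^+ mu_o (4 * i + 3)%N pi).
Proof.
move=> leN; rewrite /omega2_prime; congr (_ * (1 + _)).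
rewrite (big_cat_nat (leq0n _) leN) /= [X in _ + X]big_nat_cond.
rewrite [X in _ + X]big1 ?addr0 // => i /andP[/andP[le_i _] _].
suff /negPf-> : (4 * i + 3)%N \notin pi by rewrite mul0r.
apply/negP => pi_i; suff : (4 * i + 3 <= sumn pi)%N by lia.
elim: pi pi_i {leN le_i} => //= y s IHs.
by rewrite inE => /orP[/eqP<-|/IHs]; lia.
Qed.

(* Main.v *)
(* Work with a nilpotent q and write (a)_n for (a; q)_n. Conjugating a partition
   into k distinct parts turns its weight into a product over the part sizes
   1..k, so the left side is
     L = \sum_k q^(k(k+1)/2) (-q)_k / (q)_k^2.
   Adding the parts in increasing order of size evaluates the right side as
     (-q)_oo / (q)_oo * (1 - q F(q^2, q)),
     F(x, y) = \sum_j (-x)^j / \prod_(i <= j) (1 + y q^(2i)).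
   By the q-binomial theorem and Euler's identity,
     L (q)_oo / (-q)_oo = 1 - q v_1,
     v_m = (-q)_oo \sum_j (-q)^j / ((q)_j (1 + q^(m+j))),
   and a telescoping gives (1 + q^m) v_m + q^(m+1) v_(m+1) = 1.
   Since (1 + y) F(x, y) + x F(x, y q^2) = 1 = (1 + x) F(x, y) + y F(x q^2, y),
   alternately raising y and x shows that F(q^2, q), F(q^2, q^3), F(q^4, q^3), ...
   obeys the same recurrence, which has only one solution; hence
   v_1 = F(q^2, q). *)
Require Import Defs.
From mathcomp Require Import all_boot all_order all_algebra.
From mathcomp Require Import zify ring qpoly.

Set Implicit Arguments.
Unset Strict Implicit.
Unset Printing Implicit Defensive.

Import Order.TTheory GRing.Theory Num.Theory.
Local Open Scope ring_scope.

(** * q-series at a nilpotent q *)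

Section NilpotentSeries.

Variables (R : comUnitRingType) (q : R) (N : nat).
Hypotheses (N0 : (0 < N)%N) (qN : q ^+ N = 0).

Lemma expr_nilp n : (N <= n)%N -> q ^+ n = 0.
Proof. by move=> le_Nn; rewrite -(subnKC le_Nn) exprD qN mul0r. Qed.

Lemma expX_nilp m : (0 < m)%N -> (q ^+ m) ^+ N = 0.
Proof. by move=> m0; rewrite -exprM expr_nilp // leq_pmull. Qed.

Lemma expXN_nilp m : (0 < m)%N -> (- q ^+ m) ^+ N = 0.
Proof. by move=> m0; rewrite exprNn expX_nilp ?mulr0. Qed.

Lemma geometric_nilp (x : R) : x ^+ N = 0 -> (1 - x) * (\sum_(j < N) x ^+ j) = 1.
Proof. by move=> xN; rewrite -opprB mulNr -subrX1 xN sub0r opprK. Qed.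

Lemma unit_1B_nilp (x : R) : x ^+ N = 0 -> 1 - x \is a GRing.unit.
Proof.
move=> /geometric_nilp geo; apply/unitrP.
by exists (\sum_(j < N) x ^+ j); rewrite mulrC geo.
Qed.

Lemma unit_1BX m : (0 < m)%N -> 1 - q ^+ m \is a GRing.unit.
Proof. by move=> /expX_nilp /unit_1B_nilp. Qed.

Lemma unit_1DX m : (0 < m)%N -> 1 + q ^+ m \is a GRing.unit.
Proof. by move=> /expXN_nilp /unit_1B_nilp; rewrite opprK. Qed.

Hint Resolve unit_1BX unit_1DX : core.

(** Lets truncated series be reindexed like infinite ones: in each use [H 0] has a factor
    [1 - q ^+ 0] and [H N] vanishes by nilpotency. *)
Lemma sum_shift (H : nat -> R) : H 0 = 0 -> H N = 0 ->
  \sum_(j < N) H j = \sum_(j < N) H j.+1.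
Proof.
move=> H0 HN; transitivity (\sum_(j < N.+1) H j).
  by rewrite big_ord_recr /= HN addr0.
by rewrite big_ord_recl H0 add0r.
Qed.

Lemma sum_telescope (G : nat -> R) : \sum_(j < N) (G j - G j.+1) = G 0 - G N.
Proof.
rewrite -opprB -telescope_sumr // big_mkord -sumrN.
by apply: eq_bigr => j _; rewrite opprB.
Qed.

(* (q; q)_n and (-q; q)_n. *)
Definition pochB n := \prod_(i < n) (1 - q ^+ i.+1).
Definition pochD n := \prod_(i < n) (1 + q ^+ i.+1).

Lemma pochBS n : pochB n.+1 = pochB n * (1 - q ^+ n.+1).
Proof. exact: big_ord_recr. Qed.

Lemma pochDS n : pochD n.+1 = pochD n * (1 + q ^+ n.+1).
Proof. exact: big_ord_recr. Qed.

Lemma pochB0 : pochB 0 = 1. Proof. exact: big_ord0. Qed.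
Lemma pochD0 : pochD 0 = 1. Proof. exact: big_ord0. Qed.

Lemma unit_pochB n : pochB n \is a GRing.unit.
Proof.
elim: n => [|n IHn]; first by rewrite pochB0 unitr1.
by rewrite pochBS unitrM IHn unit_1BX.
Qed.

Lemma unit_pochD n : pochD n \is a GRing.unit.
Proof.
elim: n => [|n IHn]; first by rewrite pochD0 unitr1.
by rewrite pochDS unitrM IHn unit_1DX.
Qed.

Hint Resolve unit_pochB unit_pochD : core.

Lemma mulr_pochBS x n : x * (1 - q ^+ n.+1) / pochB n.+1 = x / pochB n.
Proof. by rewrite pochBS invrM ?unit_pochB ?unit_1BX // mulrA mulrK ?unit_1BX. Qed.

(* Stands for infinity: the two products above are stationary from N on, and
   the even bound suits [partition_recE]. *)
Let oo := N.*2.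

(** * Euler's series for the product of $1 + q^i$ over $i > m$ *)

Definition euler_sum m := \sum_(k < N) q ^+ (m * k + 'C(k.+1, 2)) / pochB k.

(** In the difference of consecutive sums a factor $1 - q^k$ appears and cancels the last factor of
    [pochB k]; shifting $k$ gives back [euler_sum m.+1], times [q ^+ m.+1]. *)
Lemma euler_sumS m : euler_sum m = (1 + q ^+ m.+1) * euler_sum m.+1.
Proof.
rewrite mulrDl mul1r addrC; apply/eqP; rewrite -subr_eq -sumrB; apply/eqP.
pose H k := q ^+ (m * k + 'C(k.+1, 2)) * (1 - q ^+ k) / pochB k.
transitivity (\sum_(k < N) H k).
  apply: eq_bigr => k _; rewrite /H mulSn -addnA.
  by rewrite !exprD; ring.
rewrite sum_shift /H ?expr0 ?subrr ?mulr0 ?mul0r //; last first.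
  by rewrite expr_nilp ?mul0r // binS bin1 addnA leq_addl.
rewrite mulr_sumr; apply: eq_bigr => k _.
rewrite mulr_pochBS mulrA -exprD; congr (q ^+ _ / _).
by rewrite binS bin1; lia.
Qed.

Lemma euler_sumE m : (m <= oo)%N -> pochD m * euler_sum m = pochD oo.
Proof.
have inv k : pochD (m + k) * euler_sum (m + k) = pochD m * euler_sum m.
  elim: k => [|k IHk]; first by rewrite addn0.
  by rewrite -IHk addnS pochDS -mulrA -euler_sumS.
(* At index [oo] only the term $k = 0$ survives, since all other exponents are at least [N]. *)
move=> le_m; rewrite -(inv (oo - m)%N) subnKC // /euler_sum -(prednK N0) big_ord_recl.
rewrite big1 ?addr0 => [|k _]; first by rewrite muln0 expr0 pochB0 divr1 mulr1.
by rewrite expr_nilp ?mul0r // /oo lift0; nia.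
Qed.

(** * The q-binomial theorem and its cases $a = -1$ and $a = 0$ *)

Lemma sum_geometric0 (c : nat -> R) (z : R) : z = 0 ->
  \sum_(j < N) c j * z ^+ j = c 0.
Proof.
move=> ->; rewrite -(prednK N0) big_ord_recl expr0 mulr1 big1 ?addr0 // => j _.
by rewrite expr0n mulr0.
Qed.

(** The functional equation whose iteration $z \mapsto zq$ yields the theorem, for $c_j = c_0 (a)_j
    / (q)_j$. Subtracting the series at $zq$ from the one at $z$ brings out $1 - q^j$, which the
    recurrence of [c] trades for a term of index $j - 1$. *)
Lemma qbinomial (a : R) (c : nat -> R) (z : R) :
    (forall j, c j.+1 * (1 - q ^+ j.+1) = c j * (1 - a * q ^+ j)) ->
    z ^+ N = 0 ->
  (1 - z) * (\sum_(j < N) c j * z ^+ j) =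
  (1 - a * z) * (\sum_(j < N) c j * (z * q) ^+ j).
Proof.
move=> cS zN; pose H j := c j * (1 - q ^+ j) * z ^+ j.
suff: \sum_(j < N) c j * z ^+ j - \sum_(j < N) c j * (z * q) ^+ j =
      z * (\sum_(j < N) c j * z ^+ j) - a * z * (\sum_(j < N) c j * (z * q) ^+ j).
  move: (\sum_(j < N) c j * z ^+ j) (\sum_(j < N) c j * (z * q) ^+ j) => A B.
  by move/(canRL (subrK _)) => AE; rewrite mulrBl mul1r {1}AE; ring.
rewrite !mulr_sumr -!sumrB; transitivity (\sum_(j < N) H j).
  by apply: eq_bigr => j _; rewrite /H exprMn; ring.
rewrite sum_shift /H ?expr0 ?subrr ?mulr0 ?mul0r ?zN ?mulr0 //.
by apply: eq_bigr => j _; rewrite cS exprMn exprS; ring.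
Qed.

(** This is $(-1)_n / (q)_n$. *)
Definition qbinom_coef n := (\prod_(i < n) (1 + q ^+ i)) / pochB n.

Lemma qbinom_coefS j : qbinom_coef j.+1 = 2 * pochD j / pochB j.+1.
Proof. by rewrite /qbinom_coef big_ord_recl expr0. Qed.

Definition qbinom_sum m := \sum_(j < N) qbinom_coef j * (- q ^+ m) ^+ j.

(** The q-binomial theorem sums [qbinom_sum k.+1] to $(q^{k+1})_\infty / (-q^{k+1})_\infty$;
    [qbinomial] is iterated until the argument becomes 0. *)
Lemma qbinom_sumE k : pochD oo * (pochB k * qbinom_sum k.+1) = pochD k * pochB oo.
Proof.
have inv n : pochB n * qbinom_sum n.+1 = pochD n * qbinom_sum 1.
  elim: n => [|n IHn]; first by rewrite pochB0 pochD0.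
  rewrite pochBS pochDS [RHS]mulrAC -IHn -!mulrA [X in _ = _ * X]mulrC; congr (_ * _).
  have := @qbinomial (-1) qbinom_coef (- q ^+ n.+1) _ (expXN_nilp (ltn0Sn n)).
  rewrite opprK mulN1r opprK -/(qbinom_sum n.+1) => ->; last first.
    by move=> j; rewrite /qbinom_coef big_ord_recr mulN1r opprK /= mulrAC mulr_pochBS mulrAC.
  by congr (_ * _); apply: eq_bigr => j _; rewrite mulNr -exprSr.
have := inv oo; rewrite {1}/qbinom_sum sum_geometric0 => [|]; last first.
  by rewrite expr_nilp ?oppr0 // /oo; lia.
rewrite /qbinom_coef big_ord0 pochB0 invr1 !mulr1 => ->.
by rewrite inv; ring.
Qed.

(** The case $a = 0$, $z = -q$, where the series is $1 / (-q)_\infty$. *)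
Lemma sum_pochB_inv : pochD oo * (\sum_(j < N) (- q) ^+ j / pochB j) = 1.
Proof.
pose h m := \sum_(j < N) (pochB j)^-1 * (- q ^+ m) ^+ j.
have inv n : pochD n * h 1 = h n.+1.
  elim: n => [|n IHn]; first by rewrite pochD0 mul1r.
  rewrite pochDS mulrAC IHn mulrC.
  have := @qbinomial 0 (fun j => (pochB j)^-1) (- q ^+ n.+1) _ (expXN_nilp (ltn0Sn n)).
  rewrite opprK mul0r subr0 mul1r => ->.
    by apply: eq_bigr => j _; rewrite mulNr -exprSr.
  by move=> j; rewrite mul0r subr0 mulr1 mulrC -[_ * _^-1]mul1r mulrA mulr_pochBS mul1r.
transitivity (h oo.+1); last first.
  rewrite /h (sum_geometric0 (fun j => (pochB j)^-1)) ?pochB0 ?invr1 //.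
  by rewrite expr_nilp ?oppr0 // /oo; lia.
by rewrite -inv; congr (_ * _); apply: eq_bigr => j _; rewrite mulrC.
Qed.

(** * Reduction of the distinct-parts series to $v_1$ *)

Definition heine_sum m := pochD oo * \sum_(j < N) (- q) ^+ j / pochB j / (1 + q ^+ (m + j)).

(** After an index shift in the second sum, the numerators add up to $1 + q^m - q^m (1 - q^j) = 1 +
    q^{m+j}$, which cancels the denominator and leaves [sum_pochB_inv]. *)
Lemma heine_sum_rec m : (0 < m)%N ->
  (1 + q ^+ m) * heine_sum m + q ^+ m.+1 * heine_sum m.+1 = 1.
Proof.
move=> m0; rewrite -[RHS]sum_pochB_inv /heine_sum
   !(mulrCA _ (pochD oo)) -mulrDr; congr (_ * _).
pose H j := - ((- q) ^+ j * q ^+ m) * (1 - q ^+ j) / pochB j / (1 + q ^+ (m + j)).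
have -> : q ^+ m.+1 * (\sum_(j < N) (- q) ^+ j / pochB j / (1 + q ^+ (m.+1 + j))) =
          \sum_(j < N) H j.
  rewrite sum_shift; first last.
  - by rewrite /H -[q]expr1 expXN_nilp ?mul0r ?oppr0 ?mul0r.
  - by rewrite /H expr0 subrr mulr0 !mul0r.
  rewrite mulr_sumr; apply: eq_bigr => j _.
  by rewrite /H mulr_pochBS addnS addSn !exprS; ring.
rewrite mulr_sumr -big_split /=; apply: eq_bigr => j _.
have u : 1 + q ^+ (m + j) \is a GRing.unit by rewrite unit_1DX // addn_gt0 m0.
by rewrite /H -[RHS](mulrK u) exprD; ring.
Qed.

Lemma distinct_sumE :
  (\sum_(k < N) q ^+ 'C(k.+1, 2) * pochD k / pochB k ^+ 2) * pochB oo =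
  pochD oo * (1 - q * heine_sum 1).
Proof.
(* [qbinom_sumE] expands $(-q)_k / (q)_k$ as a series in $j$; once the sums are exchanged, the inner
   sum over $k$ is [euler_sum j]. *)
transitivity (pochD oo * \sum_(j < N) qbinom_coef j * (- q) ^+ j * euler_sum j).
  under [in RHS]eq_bigr => j _ do rewrite mulr_sumr.
  rewrite exchange_big mulr_suml mulr_sumr; apply: eq_bigr => k _ /=.
  transitivity (q ^+ 'C(k.+1, 2) / pochB k * (pochD oo * qbinom_sum k.+1)).
    rewrite -[in RHS](mulKr (unit_pochB k) (qbinom_sum _)) (mulrCA (pochD _)) qbinom_sumE.
    by rewrite expr2 invrM //; ring.
  rewrite /qbinom_sum mulrCA !mulr_sumr; apply: eq_bigr => j _.
  by rewrite exprD (exprS q k) -mulNr exprMn -exprM (mulnC k); ring.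
congr (_ * _).
(* Since $(-1)_j / (-q)_j = 2 / (1 + q^j) = 1 + (1 - q^j) / (1 + q^j)$, the summand splits into that
   of [sum_pochB_inv] and [H j], which shifts to $-q v_1$. *)
pose H j := (- q) ^+ j * (1 - q ^+ j) / pochB j / (1 + q ^+ j).
have -> : q * heine_sum 1 = - (pochD oo * \sum_(j < N) H j).
  rewrite sum_shift; first last.
  - by rewrite /H -[q]expr1 expXN_nilp ?mul0r.
  - by rewrite /H expr0 subrr mulr0 !mul0r.
  rewrite /heine_sum !mulr_sumr -sumrN; apply: eq_bigr => j _.
  by rewrite /H mulr_pochBS add1n (exprS (- q)); ring.
rewrite opprK -[X in _ = X + _]sum_pochB_inv -mulrDr -big_split mulr_sumr /=.
apply: eq_bigr => j _.
have -> : euler_sum j = pochD oo / pochD j.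
  by rewrite mulrC -(@euler_sumE j) ?mulKr // /oo
     -addnn (leq_trans (ltnW (ltn_ord j))) ?leq_addr.
(* Index 0 is treated apart because there $1 + q^j = 2$ need not be a unit. *)
case: {j}(nat_of_ord j) => [|j].
  by rewrite /H /qbinom_coef big_ord0 pochB0 pochD0 !expr0 subrr
     mulr0 !divr1 !mul0r addr0 !(mul1r, mulr1).
have u : 1 + q ^+ j.+1 \is a GRing.unit by exact: unit_1DX.
transitivity (pochD oo * ((- q) ^+ j.+1 / pochB j.+1) *
    (2 / (1 + q ^+ j.+1)) * (pochD j / pochD j)).
  by rewrite qbinom_coefS pochDS invrM //; ring.
have -> : 2 / (1 + q ^+ j.+1) = 1 + (1 - q ^+ j.+1) / (1 + q ^+ j.+1).
  by rewrite -[X in _ = X + _](divrr u); ring.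
by rewrite divrr // /H; ring.
Qed.

(** * Fine's function in base $q^2$ with first parameter zero, up to the factor $1 / (1 + y)$ *)

Definition fine_den j (y : R) := \prod_(i < j) (1 + y * q ^+ (2 * i)).
Definition fine_sum (x y : R) := \sum_(j < N) (- x) ^+ j / fine_den j.+1 y.

Lemma fine_denS j y : fine_den j.+1 y = fine_den j y * (1 + y * q ^+ (2 * j)).
Proof. exact: big_ord_recr. Qed.

Lemma fine_denSl j y : fine_den j.+1 y = (1 + y) * fine_den j (y * q ^+ 2).
Proof.
rewrite /fine_den big_ord_recl expr0 mulr1; congr (_ * _).
by apply: eq_bigr => i _; rewrite lift0 mulnS exprD mulrA.
Qed.

Lemma unit_1DXM m i : (0 < m)%N -> 1 + q ^+ m * q ^+ i \is a GRing.unit.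
Proof. by move=> m0; rewrite -exprD unit_1DX // addn_gt0 m0. Qed.

Lemma unit_fine_den m j : (0 < m)%N -> fine_den j (q ^+ m) \is a GRing.unit.
Proof.
move=> m0; elim: j => [|j IHj]; first by rewrite /fine_den big_ord0 unitr1.
by rewrite fine_denS unitrM IHj unit_1DXM.
Qed.

(** Peeling off the first factor of the denominator, which is $1 + y$, makes the sum telescope. *)
Lemma fine_sum_recr a b : (0 < a)%N -> (0 < b)%N ->
  (1 + q ^+ b) * fine_sum (q ^+ a) (q ^+ b) + q ^+ a * fine_sum (q ^+ a) (q ^+ b.+2) = 1.
Proof.
move=> a0 b0; rewrite !mulr_sumr -big_split /=.
pose G j := (- q ^+ a) ^+ j / fine_den j (q ^+ b.+2).
transitivity (G 0%N - G N); last first.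
  by rewrite /G expr0 expXN_nilp // mul0r subr0 /fine_den big_ord0 divr1.
rewrite -sum_telescope; apply: eq_bigr => j _; rewrite /G (exprS (- q ^+ a)).
have -> : fine_den j.+1 (q ^+ b) = (1 + q ^+ b) * fine_den j (q ^+ b.+2).
  by rewrite fine_denSl -exprD addn2.
have u : 1 + q ^+ b \is a GRing.unit by exact: unit_1DX.
rewrite [in LHS]invrM ?unit_fine_den //.
by rewrite -[X in _ = X - _](mulrK u); ring.
Qed.

(** Here the last factor is used: $1 + x + y q^{2j}$ is $x$ plus the last factor of [fine_den j.+1],
    so the sum telescopes again. *)
Lemma fine_sum_recl a b : (0 < a)%N -> (0 < b)%N ->
  (1 + q ^+ a) * fine_sum (q ^+ a) (q ^+ b) + q ^+ b * fine_sum (q ^+ a.+2) (q ^+ b) = 1.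
Proof.
move=> a0 b0; rewrite !mulr_sumr -big_split /=.
pose G j := (- q ^+ a) ^+ j / fine_den j (q ^+ b).
transitivity (G 0%N - G N); last first.
  by rewrite /G expr0 expXN_nilp // mul0r subr0 /fine_den big_ord0 divr1.
rewrite -sum_telescope; apply: eq_bigr => j _; rewrite /G (exprS (- q ^+ a)).
have u : 1 + q ^+ b * q ^+ (2 * j) \is a GRing.unit by exact: unit_1DXM.
have -> : (fine_den j (q ^+ b))^-1 = (1 + q ^+ b * q ^+ (2 * j)) / fine_den j.+1 (q ^+ b).
  by rewrite fine_denS invrM ?unit_fine_den // mulrA divrr // mul1r.
by rewrite -(addn2 a) exprD -mulNr exprMn -exprM; ring.
Qed.

(** Downward induction: for $m \ge N$ the second term vanishes and the unit $1 + q^m$ determines the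
    value; each smaller index then follows from the next one. *)
Lemma rec_unique (u v : nat -> R) :
    (forall m, (0 < m)%N -> (1 + q ^+ m) * u m + q ^+ m.+1 * u m.+1 = 1) ->
    (forall m, (0 < m)%N -> (1 + q ^+ m) * v m + q ^+ m.+1 * v m.+1 = 1) ->
  u 1 = v 1.
Proof.
move=> uP vP; suff: forall k m, (0 < m)%N -> (N <= m + k)%N -> u m = v m.
  by move/(_ N 1%N); apply => //; rewrite leq_addl.
elim=> [|k IHk] m m0 le_N; apply: (mulrI (unit_1DX m0)).
  have := etrans (uP m m0) (esym (vP m m0)).
  by rewrite !(expr_nilp (n := m.+1)) ?mul0r ?addr0 //; lia.
have := etrans (uP m m0) (esym (vP m m0)); rewrite (IHk m.+1) //; last lia.
by move/addIr.
Qed.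

(* F(q^2, q), F(q^2, q^3), F(q^4, q^3), ... from index 1 on. *)
Definition fine_seq n : R :=
  if odd n then fine_sum (q ^+ n.+1) (q ^+ n) else fine_sum (q ^+ n) (q ^+ n.+1).

Lemma fine_seq_rec m : (0 < m)%N ->
  (1 + q ^+ m) * fine_seq m + q ^+ m.+1 * fine_seq m.+1 = 1.
Proof.
by move=> m0; rewrite /fine_seq /=; case: (odd m); rewrite ?fine_sum_recr ?fine_sum_recl.
Qed.

Lemma heine_fine_sum : heine_sum 1 = fine_sum (q ^+ 2) q.
Proof. exact: (rec_unique heine_sum_rec fine_seq_rec). Qed.

(** * Solving the recurrences of the two sides *)

Lemma partition_recE (a b : nat -> R) :
    a 0 = 1 -> b 0 = 0 ->
    (forall j, a j.+1 * (1 - q ^+ j.+1) = a j * (if odd j then 1 + q ^+ j.+1 else 1)) ->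
    (forall j, b j.+1 * (1 - q ^+ j.+1) =
       b j * (1 + q ^+ j.+1) + (j.+1 %% 4 == 3)%N%:R * 2 * q ^+ j.+1 * a j) ->
  (a oo + b oo) * pochB oo = pochD oo * (1 - q * fine_sum (q ^+ 2) q).
Proof.
move=> a0 b0 aS bS.
pose S m := \sum_(j < m) (- q ^+ 2) ^+ j / fine_den j.+1 q.
rewrite -[fine_sum _ _]/(S N) /oo.
(* Part sizes are added in pairs $2m+1$, $2m+2$, so that each pair contributes exactly one term of
   [S]. *)
suff: forall m, a m.*2 * pochB m.*2 = pochD m.*2 / fine_den m q /\
    (a m.*2 + b m.*2) * pochB m.*2 = pochD m.*2 * (1 - q * S m).
  by move=> /(_ N)[].
have uT m : fine_den m q \is a GRing.unit.
  by rewrite -[X in fine_den _ X]expr1 unit_fine_den.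
elim=> [|m [IHa IHb]].
  rewrite /= a0 b0 pochB0 pochD0 /fine_den /S !big_ord0 divr1 !mulr1 mulr0 subr0.
  by split; ring.
have aS1 := aS m.*2; have bS1 := bS m.*2; have aS2 := aS m.*2.+1; have bS2 := bS m.*2.+1.
rewrite /= odd_double /= in aS1 aS2.
have bS2' : b m.*2.+2 * (1 - q ^+ m.*2.+2) = b m.*2.+1 * (1 + q ^+ m.*2.+2).
  by rewrite bS2 (_ : _ == _ = false) ?mul0r ?addr0 //; lia.
(* $2m + 1 \equiv 3 \pmod 4$ exactly when $m$ is odd, and twice that indicator is $1 - (-1)^m$. *)
have bS1' : b m.*2.+1 * (1 - q ^+ m.*2.+1) =
    b m.*2 * (1 + q ^+ m.*2.+1) + (1 - (-1) ^+ m) * q ^+ m.*2.+1 * a m.*2.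
  rewrite bS1 (_ : _ == _ = odd m); last by lia.
  by rewrite -(signr_odd _ m); case: (odd m); rewrite /= ?expr0 ?expr1; ring.
have TS : (fine_den m q)^-1 = (1 + q ^+ m.*2.+1) / fine_den m.+1 q.
  have u : 1 + q * q ^+ (2 * m) \is a GRing.unit.
    by rewrite -exprS unit_1DX.
  by rewrite fine_denS invrM // mulrA exprS mul2n divrr ?mul1r // -mul2n.
have A1 : a m.*2.+1 * (1 - q ^+ m.*2.+1) = a m.*2 by rewrite aS1 mulr1.
have Aeq : a m.*2.+2 * pochB m.*2.+2 = (1 + q ^+ m.*2.+2) * (a m.*2 * pochB m.*2).
  rewrite !pochBS -A1.
  transitivity ((a m.*2.+2 * (1 - q ^+ m.*2.+2)) * pochB m.*2 * (1 - q ^+ m.*2.+1));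
    first by ring.
  by rewrite aS2; ring.
have Beq : b m.*2.+2 * pochB m.*2.+2 = (1 + q ^+ m.*2.+2) *
    (b m.*2 * (1 + q ^+ m.*2.+1) + (1 - (-1) ^+ m) * q ^+ m.*2.+1 * a m.*2) * pochB m.*2.
  rewrite !pochBS -bS1'.
  transitivity ((b m.*2.+2 * (1 - q ^+ m.*2.+2)) * pochB m.*2 * (1 - q ^+ m.*2.+1));
    first by ring.
  by rewrite bS2'; ring.
split; first by rewrite doubleS Aeq IHa TS !pochDS; ring.
rewrite doubleS mulrDl Aeq Beq.
(* In [a + b] the plain $q^{2m+1}$ terms cancel; what remains, $-(-1)^m q^{2m+1}$ times [a m.*2],
   supplies the new term of [S]. *)
transitivity ((1 + q ^+ m.*2.+2) * ((1 + q ^+ m.*2.+1) * ((a m.*2 + b m.*2) * pochB m.*2)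
   - (-1) ^+ m * q ^+ m.*2.+1 * (a m.*2 * pochB m.*2))); first by ring.
rewrite IHb IHa TS !pochDS /S big_ord_recr /= -/(S m)
  (exprNn (q ^+ 2)) -exprM -mul2n [q ^+ (2 * m).+1]exprS.
by ring.
Qed.

(** Generating function of a single gap. The partial sums have a closed form whose remainder is a
    multiple of $x^n$. *)
Lemma sum_odd_coef (x : R) : x ^+ N = 0 ->
  (1 - x) ^+ 2 * (\sum_(0 <= d < N) (2 * d.+1%:R - 1) * x ^+ d.+1) = x * (1 + x).
Proof.
move=> xN.
have E n : (1 - x) ^+ 2 * (\sum_(0 <= d < n) (2 * d.+1%:R - 1) * x ^+ d.+1) =
    x * (1 + x) - (2 * n%:R + 1) * x * x ^+ n + (2 * n%:R - 1) * x ^+ 2 * x ^+ n.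
  elim: n => [|n IHn]; first by rewrite big_nil expr0; ring.
  by rewrite big_nat_recr //= mulrDr IHn !exprS -natr1; ring.
by rewrite E xN; ring.
Qed.

Lemma distinct_recE (f : nat -> R) :
    f 0 = 1 ->
    (forall k, f k.+1 = f k * \sum_(0 <= d < N) (2 * d.+1%:R - 1) * (q ^+ k.+1) ^+ d.+1) ->
  forall k, f k = q ^+ 'C(k.+1, 2) * pochD k / pochB k ^+ 2.
Proof.
move=> f0 fS; elim=> [|k IHk].
  by rewrite f0 pochB0 pochD0 expr1n divr1 expr0 mulr1.
have u := unit_1BX (ltn0Sn k); have uB := unit_pochB k.
have eC : 'C(k.+2, 2) = (k.+1 + 'C(k.+1, 2))%N by rewrite binS bin1 addnC.
apply: (mulIr (unitrX 2 u)).
rewrite fS -[LHS]mulrA [X in _ * X = _]mulrC sum_odd_coef ?expX_nilp //.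
rewrite IHk pochBS pochDS eC exprD exprMn [in RHS]invrM ?unitrX //.
by rewrite -[LHS](mulrK (unitrX 2 u)); ring.
Qed.

(** The algebra isolated from the combinatorics: [f k] will be the sum over partitions into [k]
    distinct parts, while [a j] and [b j] come from the two terms of $1 + \sum$ in $\omega_2'$, over
    partitions with parts at most [j]. *)
Lemma nilpotent_identity (f a b : nat -> R) :
    f 0 = 1 ->
    (forall k, f k.+1 = f k * \sum_(0 <= d < N) (2 * d.+1%:R - 1) * (q ^+ k.+1) ^+ d.+1) ->
    a 0 = 1 -> b 0 = 0 ->
    (forall j, a j.+1 * (1 - q ^+ j.+1) = a j * (if odd j then 1 + q ^+ j.+1 else 1)) ->
    (forall j, b j.+1 * (1 - q ^+ j.+1) =
       b j * (1 + q ^+ j.+1) + (j.+1 %% 4 == 3)%N%:R * 2 * q ^+ j.+1 * a j) ->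
  \sum_(k < N) f k = a oo + b oo.
Proof.
move=> f0 fS a0 b0 aS bS; apply: (mulIr (unit_pochB oo)).
rewrite partition_recE // -heine_fine_sum -distinct_sumE.
by congr (_ * _); apply: eq_bigr => k _; exact: distinct_recE.
Qed.

End NilpotentSeries.

(** * Coefficients of generating series *)

(** Allows [partitions_of] to be replaced by recursively built lists, which may also contain
    partitions of other numbers. *)
Lemma gen_series_enum (A : pred (seq nat)) (w : seq nat -> int) (E : seq (seq nat)) n :
    uniq E -> {in E, forall s, partU s && A s} ->
    (forall s, partU s -> A s -> sumn s = n -> s \in E) ->
  gen_series A w n = \sum_(s <- E | sumn s == n) w s.
Proof.
move=> uE EA AE; rewrite /gen_series -big_filter -[RHS]big_filter.
apply/perm_big/uniq_perm => [||s].
- exact/filter_uniq/partitions_of_uniq.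
- exact: filter_uniq.
rewrite mem_filter mem_partitions_of mem_filter andbC; apply/andP/andP => -[].
  by case/andP=> Us /[dup] sn /eqP /AE E_s As; rewrite sn E_s.
by move=> sn /EA /andP[-> ->].
Qed.

(* Instantiated at the class of 'X in rat['X]/('X^(N+1)). *)
Lemma eq_coef_nilpotent (w1 w2 : seq nat -> int) (E1 E2 : seq (seq nat)) N :
    (forall (R : comUnitRingType) (q : R), q ^+ N.+1 = 0 ->
      \sum_(s <- E1) (w1 s)%:~R * q ^+ sumn s =
      \sum_(s <- E2) (w2 s)%:~R * q ^+ sumn s) ->
  \sum_(s <- E1 | sumn s == N) w1 s = \sum_(s <- E2 | sumn s == N) w2 s.
Proof.
move=> eqR.
pose P (w : seq nat -> int) E : {poly rat} := \sum_(s <- E) (w s)%:~R *: 'X^(sumn s).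
have coefP w E : (P w E)`_N = (\sum_(s <- E | sumn s == N) w s)%:~R.
  rewrite /P coef_sum rmorph_sum /= [RHS]big_mkcond; apply: eq_bigr => s _.
  by rewrite coefZ coefXn eq_sym; case: eqP => _; rewrite ?mulr1 ?mulr0.
apply: (@intr_inj rat); rewrite -!coefP.
pose h : {poly rat} := 'X^(N.+1).
pose phi : {rmorphism {poly rat} -> {poly %/ h}} := in_qpoly h.
have phiP w E : phi (P w E) = \sum_(s <- E) (w s)%:~R * phi 'X ^+ sumn s.
  rewrite rmorph_sum; apply: eq_bigr => s _.
  rewrite -mul_polyC rmorphM rmorphXn; congr (_ * _).
  by rewrite -(rmorph_int phi); congr (phi _); rewrite rmorph_int.
have hE : mk_monic h = h by rewrite /h mk_monic_Xn.
have X0 : phi 'X ^+ N.+1 = 0.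
  by rewrite -rmorphXn; apply/val_inj; rewrite /= hE Pdiv.RingMonic.rmodpp // monicXn.
have := eqR _ _ X0; rewrite -!phiP => /(congr1 val) /=.
rewrite hE -!Pdiv.RingMonic.take_poly_rmodp => /(congr1 (fun p : {poly rat} => p`_N)).
by rewrite !coef_take_poly leqnn.
Qed.

(** * Enumerations of partitions *)

Lemma mem_leq_sumn x s : x \in s -> (x <= sumn s)%N.
Proof.
elim: s => //= y s IHs; rewrite inE => /orP[/eqP->|/IHs]; lia.
Qed.

(** Recursion on the largest allowed part, with all multiplicities below [N]; this still covers
    every partition of a number below [N] with parts at most [M]. *)
Fixpoint partitions_leq N M : seq (seq nat) :=
  if M is M'.+1 then [seq nseq c M ++ s | c <- iota 0 N, s <- partitions_leq N M']
  else [:: [::]].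

Lemma partitions_leq_bound N M :
  {in partitions_leq N M, forall s, partU s && all (leq^~ M) s}.
Proof.
elim: M => [|M IHM] s /=; first by rewrite inE => /eqP->.
case/allpairsP=> -[c t] /= [_ /IHM /andP[/andP[st t0] tM] ->].
rewrite /partU mem_cat negb_or t0 mem_nseq andbF andbT all_cat all_nseq leqnn orbT /=.
rewrite (sub_all _ tM) ?andbT => [|x /leqW //].
elim: c => //= c IHc; rewrite path_min_sorted // all_cat all_nseq /= leqnn orbT /=.
by apply: sub_all tM => x /leqW.
Qed.

Lemma count_mem_bound M s : all (leq^~ M) s -> count_mem M.+1 s = 0.
Proof.
move=> /allP sM; apply/count_memPn/negP => /sM; lia.
Qed.

Lemma partitions_leq_uniq N M : uniq (partitions_leq N M).
Proof.
elim: M => //= M IHM; apply: allpairs_uniq; rewrite ?iota_uniq // => -[c s] [d t].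
move=> /allpairsP[[c' s'] /= [_ /partitions_leq_bound /andP[_ sM] [-> ->]]].
move=> /allpairsP[[d' t'] /= [_ /partitions_leq_bound /andP[_ tM] [-> ->]]] /= eq_st.
have := congr1 (count_mem M.+1) eq_st; rewrite !count_cat !count_nseq /= eqxx !mul1n.
rewrite !count_mem_bound // !addn0 => ecd; move: eq_st; rewrite ecd => /eqP.
by rewrite eqseq_cat // eqxx => /eqP->.
Qed.

Lemma partitions_leq_complete N M s :
  partU s -> all (leq^~ M) s -> (sumn s < N)%N -> s \in partitions_leq N M.
Proof.
elim: M s => [|M IHM] s /andP[ss s0] sM sN.
  by case: s s0 sM {ss sN} => [|[|x] s].
have [c [t [es [tM Ut]]]] : exists c t, s = nseq c M.+1 ++ t /\ all (leq^~ M) t /\ partU t.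
  elim: s {sN} ss s0 sM => [|x s IHs] /=; first by exists 0%N, [::].
  rewrite inE negb_or => ss /andP[x0 s0] /andP[xM sM].
  have [eqx|neqx] := eqVneq x M.+1.
    by have [c [t [-> Ht]]] := IHs (path_sorted ss) s0 sM; exists c.+1, t; rewrite eqx.
  exists 0%N, (x :: s); split => //; split; last by rewrite /partU /= ss inE negb_or x0.
  apply/andP; split; first by lia.
  have := order_path_min (rev_trans leq_trans) ss; apply: sub_all => y /=; lia.
move: sN; rewrite es sumn_cat sumn_nseq => sN.
by apply/allpairsP; exists (c, t); rewrite /= mem_iota; split => //;
  [lia | apply: IHM => //; lia].
Qed.

(* Conjugation in disguise: d.+1 is the multiplicity of k'.+1 in the conjugate
   partition. *)
Fixpoint distinct_parts N k : seq (seq nat) :=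
  if k is k'.+1 then
    [seq map (addn d.+1) (rcons s 0%N) | d <- iota 0 N, s <- distinct_parts N k']
  else [:: [::]].

Lemma size_distinct_parts N k : {in distinct_parts N k, forall s, size s = k}.
Proof.
elim: k => [|k IHk] s /=; first by rewrite inE => /eqP->.
by case/allpairsP=> -[d t] /= [_ /IHk <- ->]; rewrite size_map size_rcons.
Qed.

Lemma partDE s : partD s = pairwise gtn s && (0%N \notin s).
Proof.
rewrite /partD /partU andbAC [_ && uniq s]andbC -gtn_sorted_uniq_geq.
by rewrite sorted_pairwise // => ? ? ? /[swap]; exact: ltn_trans.
Qed.

Lemma distinct_parts_partD N k : {in distinct_parts N k, forall s, partD s}.
Proof.
elim: k => [|k IHk] s /=; first by rewrite inE => /eqP->.
case/allpairsP=> -[d t] /= [_ /IHk + ->]; rewrite !partDE => /andP[pt t0].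
rewrite pairwise_map pairwise_rcons; apply/andP; split; last first.
  by apply/negP => /mapP[x _].
apply/andP; split; last by apply: sub_pairwise pt => x y /=; lia.
by apply/allP => x /= xt; have := memPn t0 x xt; lia.
Qed.

Lemma distinct_parts_uniq N k : uniq (distinct_parts N k).
Proof.
elim: k => //= k IHk; apply: allpairs_uniq; rewrite ?iota_uniq // => -[c s] [d t] _ _ /=.
rewrite !map_rcons => /rcons_inj[] /[swap]; rewrite !addn0 => -[->].
by move/(inj_map (@addnI _)) ->.
Qed.

(** The construction is undone by removing the smallest part [d] and subtracting it from the others,
    which stay distinct and positive. *)
Lemma distinct_parts_complete N s :
  partD s -> (sumn s <= N)%N -> s \in distinct_parts N (size s).
Proof.
rewrite partDE; move: {2}(size s) (erefl (size s)) => k.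
elim: k s => [|k IHk] s; first by case: s.
case/lastP: s => // t d; rewrite size_rcons => -[sz].
rewrite pairwise_rcons mem_rcons inE negb_or => /andP[/andP[td pt] /andP[d0 t0]].
rewrite sumn_rcons sz => sN /=.
have d1 : (d = d.-1.+1)%N by lia.
have et : t = map (addn d) (map (subn^~ d) t).
  rewrite -map_comp -[LHS]map_id; apply/eq_in_map => x /(allP td) /=; lia.
apply/allpairsP; exists (d.-1, map (subn^~ d) t); split.
- by rewrite mem_iota /=; lia.
- rewrite -sz -(size_map (subn^~ d) t); apply: IHk; rewrite ?size_map //.
    apply/andP; split.
      rewrite pairwise_map; apply: (sub_in_pairwise _ td) pt => x y.
      by rewrite !unfold_in /=; lia.
    by apply/negP => /mapP[x /(allP td) /=]; lia.
  apply: leq_trans sN; rewrite [in X in (_ <= X)%N]et.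
  by elim: (map _ _) => //= x s; lia.
- by rewrite -d1 map_rcons addn0 -et.
Qed.

Lemma big_iota0 (V : nmodType) (F : nat -> V) n :
  \sum_(i <- iota 0 n) F i = \sum_(i < n) F i.
Proof. by rewrite -(big_mkord xpredT) /index_iota subn0. Qed.

(* The sum over i in omega2_prime, indexed by the parts 4i+3 themselves. *)
Definition omega2_odd (s : seq nat) : int :=
  \sum_(x <- undup s | (x %% 4 == 3)%N) 2 ^+ mu_o x s.

Lemma omega2_prime_odd s : omega2_prime s = 2 ^+ nu_de s * (1 + omega2_odd s).
Proof.
rewrite /omega2_prime; congr (_ * (1 + _)).
under eq_bigr => i _ do rewrite mulr_natl mulrb.
rewrite -big_mkcond -big_filter /omega2_odd -[RHS]big_filter.
rewrite -(big_map (fun i => (4 * i + 3)%N) xpredT (fun x => 2 ^+ mu_o x s)).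
apply/perm_big/uniq_perm => [||x].
- rewrite map_inj_uniq ?filter_uniq ?iota_uniq // => i j; lia.
- by rewrite filter_uniq ?undup_uniq.
rewrite mem_filter mem_undup; apply/mapP/andP => [[i]|[x3 xs]].
  by rewrite mem_filter => /andP[si _] ->; split=> //; lia.
exists (x %/ 4)%N; last by lia.
have ex : (4 * (x %/ 4) + 3)%N = x by lia.
by rewrite mem_filter ex xs mem_index_iota /=; have := mem_leq_sumn xs; lia.
Qed.

(** * Effect of one construction step on the weights *)

Section MaxPart.
Variables (M : nat) (s : seq nat).
Hypothesis sM : all (leq^~ M) s.

Lemma undup_max c : undup (nseq c.+1 M.+1 ++ s) = M.+1 :: undup s.
Proof.
have Ms : (M.+1 \in s) = false by apply/negP => /(allP sM); rewrite ltnn.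
elim: c => [|c IHc]; first by rewrite /= Ms.
by rewrite -IHc [LHS]/= inE eqxx.
Qed.

Lemma nu_de_max c : nu_de (nseq c.+1 M.+1 ++ s) = (odd M + nu_de s)%N.
Proof. by rewrite /nu_de undup_max /= negbK. Qed.

Lemma mu_o_max x c :
  mu_o x (nseq c.+1 M.+1 ++ s) = ((~~ odd M && (x <= M.+1)) + mu_o x s)%N.
Proof. by rewrite /mu_o undup_max. Qed.

Lemma mu_o_gt x : (M < x)%N -> mu_o x s = 0.
Proof.
move=> Mx; rewrite /mu_o (@eq_in_count _ _ pred0) ?count_pred0 // => y.
by rewrite mem_undup => /(allP sM) /= yM; apply/negbTE; lia.
Qed.

(** The factor [2 ^+ odd M] is the gain of [nu_de]. An even new part doubles through it, an odd one
    by raising every [mu_o] by 1; a new part congruent to 3 mod 4 adds its own term $2^1$. *)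
Lemma omega2_odd_max c : (2 : int) ^+ odd M * omega2_odd (nseq c.+1 M.+1 ++ s) =
  2 * omega2_odd s + (M.+1 %% 4 == 3)%N%:R * 2.
Proof.
rewrite /omega2_odd undup_max big_cons mu_o_max mu_o_gt // leqnn andbT addn0.
have -> : \sum_(x <- undup s | (x %% 4 == 3)%N) 2 ^+ mu_o x (nseq c.+1 M.+1 ++ s) =
          (2 : int) ^+ (~~ odd M) * omega2_odd s.
  rewrite mulr_sumr big_seq_cond [RHS]big_seq_cond; apply: eq_bigr => x.
  rewrite mem_undup => /andP[/(allP sM) /= xM _].
  by rewrite mu_o_max exprD leqW // andbT.
rewrite /omega2_odd; case: eqP => [M3|_]; last by case: (odd M) => /=; ring.
have -> : odd M = false by lia.
by rewrite /=; ring.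
Qed.

End MaxPart.

(** A common shift preserves all gaps, including the one down to the appended 0; the only new gap is
    [d.+1]. *)
Lemma omega2_tilde_rec d s :
  omega2_tilde (map (addn d.+1) (rcons s 0%N)) = omega2_tilde s * (2 * d.+1%:R - 1).
Proof.
rewrite /omega2_tilde size_map size_rcons big_nat_recr //=; congr (_ * _).
  apply: eq_big_nat => i /andP[_ lt_i].
  rewrite !(nth_map 0%N) ?size_rcons; [|lia..]; rewrite !nth_rcons lt_i.
  case: ltngtP => [||es]; [lia | lia |].
  by rewrite es (nth_default _ (leqnn (size s))); lia.
rewrite (nth_map 0%N) ?size_rcons // nth_rcons ltnn eqxx addn0.
by rewrite nth_default ?size_map ?size_rcons //; lia.
Qed.

Lemma sumn_map_addn d s : sumn (map (addn d) s) = (sumn s + size s * d)%N.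
Proof. by elim: s => //= x s ->; rewrite mulSn; lia. Qed.

(** * Recurrences for the weighted sums over the enumerations *)

Section Weights.
Variables (R : comUnitRingType) (q : R) (N : nat).
Hypotheses (N0 : (0 < N)%N) (qN : q ^+ N = 0).

Definition wsum (w : seq nat -> int) E : R := \sum_(s <- E) (w s)%:~R * q ^+ sumn s.

(** Multiplicity 0 of the part [M.+1] keeps [w s]; all positive multiplicities share the weight
    [v s] and form a geometric series, summed by the factor [1 - q ^+ M.+1]. *)
Lemma wsum_partitions_leq (w v : seq nat -> int) M :
    (forall c s, all (leq^~ M) s -> w (nseq c.+1 M.+1 ++ s) = v s) ->
  wsum w (partitions_leq N M.+1) * (1 - q ^+ M.+1) =
  \sum_(s <- partitions_leq N M)
    ((w s)%:~R * (1 - q ^+ M.+1) + (v s)%:~R * q ^+ M.+1) * q ^+ sumn s.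
Proof.
move=> wv; rewrite /wsum /= big_allpairs_dep exchange_big /= mulr_suml.
apply: eq_big_seq => s /partitions_leq_bound /andP[_ sM].
have xN : (q ^+ M.+1) ^+ N = 0 by apply: expX_nilp.
rewrite -(prednK N0) in xN.
have -> : iota 0 N = 0%N :: map S (iota 0 N.-1).
  by rewrite -(iotaDl 1 0) -{1}(prednK N0).
rewrite big_cons big_map /=.
have -> : \sum_(c <- iota 0 N.-1)
    (w (nseq c.+1 M.+1 ++ s))%:~R * q ^+ sumn (nseq c.+1 M.+1 ++ s) =
    (v s)%:~R * q ^+ sumn s * q ^+ M.+1 * \sum_(c < N.-1) (q ^+ M.+1) ^+ c.
  rewrite big_iota0 mulr_sumr; apply: eq_bigr => c _.
  rewrite wv // sumn_cat sumn_nseq mulnS (exprD q (M.+1 + M.+1 * c)%N) (exprD q M.+1).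
  by rewrite (exprM q M.+1); ring.
(* The truncated series misses 1 by the power [N.-1] of [q ^+ M.+1], which the prefactor raises to
   the power [N], hence to 0. *)
have geo : q ^+ M.+1 * ((1 - q ^+ M.+1) * \sum_(c < N.-1) (q ^+ M.+1) ^+ c) = q ^+ M.+1.
  by rewrite -opprB mulNr -subrX1 mulrN mulrBr -(exprS (q ^+ M.+1)) xN; ring.
rewrite -[X in _ + _ * X]geo; ring.
Qed.

Let a M := wsum (fun s => (2 : int) ^+ nu_de s) (partitions_leq N M).
Let b M := wsum (fun s => (2 : int) ^+ nu_de s * omega2_odd s) (partitions_leq N M).

Lemma nu_de_rec j :
  a j.+1 * (1 - q ^+ j.+1) = a j * (if odd j then 1 + q ^+ j.+1 else 1).
Proof.
rewrite (@wsum_partitions_leq _ (fun s => (2 : int) ^+ odd j * 2 ^+ nu_de s)); last first.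
  by move=> c s sM; rewrite nu_de_max // exprD.
rewrite mulr_suml; apply: eq_bigr => s _.
by case: (odd j); rewrite ?rmorphM ?mul1r /=; ring.
Qed.

Lemma omega2_odd_rec j : b j.+1 * (1 - q ^+ j.+1) =
  b j * (1 + q ^+ j.+1) + (j.+1 %% 4 == 3)%N%:R * 2 * q ^+ j.+1 * a j.
Proof.
rewrite (@wsum_partitions_leq _ (fun s => (2 : int) ^+ nu_de s *
   (2 * omega2_odd s + (j.+1 %% 4 == 3)%N%:R * 2))); last first.
  by move=> c s sM; rewrite nu_de_max // -(omega2_odd_max sM c) exprD; ring.
rewrite mulr_suml mulr_sumr -big_split; apply: eq_bigr => s _.
by case: (_ == _); rewrite !(rmorphM, rmorphD) /=; ring.
Qed.

Lemma omega2_tilde_sum_rec k : wsum omega2_tilde (distinct_parts N k.+1) =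
  wsum omega2_tilde (distinct_parts N k) *
    \sum_(0 <= d < N) (2 * d.+1%:R - 1) * (q ^+ k.+1) ^+ d.+1.
Proof.
rewrite /wsum /= big_allpairs_dep exchange_big mulr_suml; apply: eq_big_seq => s sk.
rewrite mulr_sumr big_iota0 big_mkord; apply: eq_bigr => -[d /= _] _.
rewrite sumn_map_addn sumn_rcons addn0 size_rcons (size_distinct_parts sk).
by rewrite omega2_tilde_rec exprD exprM rmorphM rmorphB rmorphM /= rmorph_nat; ring.
Qed.

Lemma wsum_identity :
  \sum_(k < N) wsum omega2_tilde (distinct_parts N k) =
  wsum omega2_prime (partitions_leq N N.*2).
Proof.
have nil_sum w : wsum w [:: [::]] = (w [::])%:~R by rewrite /wsum big_seq1 mulr1.
rewrite (@nilpotent_identity _ q N N0 qN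
  (fun k => wsum omega2_tilde (distinct_parts N k)) a b) //.
- rewrite /a /b /wsum -big_split; apply: eq_bigr => s _.
  by rewrite omega2_prime_odd mulrDr mulr1 rmorphD mulrDl.
- by rewrite nil_sum /omega2_tilde big_nil.
- exact: omega2_tilde_sum_rec.
- by rewrite /a nil_sum.
- by rewrite /b nil_sum /omega2_odd big_nil mulr0.
- exact: nu_de_rec.
- exact: omega2_odd_rec.
Qed.

End Weights.

Theorem theorem4p3 :
  gen_series partD omega2_tilde =1 gen_series partU omega2_prime.
Proof.
(* Working modulo $q^{n+1}$ keeps the coefficient of $q^n$, and a partition of [n] has fewer than
   [N] parts. *)
move=> n; pose N := n.+1.
pose ED := [seq s | k <- iota 0 N, s <- distinct_parts N k].
rewrite (@gen_series_enum _ _ ED) ?(@gen_series_enum _ _ (partitions_leq N N.*2)).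
- apply: eq_coef_nilpotent => R q qN.
  rewrite big_allpairs_dep big_iota0; exact: (wsum_identity (ltn0Sn n) qN).
- exact: partitions_leq_uniq.
- by move=> s /partitions_leq_bound /andP[Us _]; rewrite Us.
- move=> s Us _ sn; apply: partitions_leq_complete; rewrite ?sn //.
  by apply/allP => x /mem_leq_sumn; rewrite sn /N; lia.
- apply: allpairs_uniq_dep => [|k _|]; [exact: iota_uniq | exact: distinct_parts_uniq |].
  move=> _ _ /allpairsPdep[k [s [_ sk ->]]] /allpairsPdep[l [t [_ tl ->]]] /= est.
  by move: sk tl; rewrite est => /size_distinct_parts <- /size_distinct_parts <-.
- move=> s /allpairsPdep[k [t [_ /distinct_parts_partD Dt ->]]].
  by rewrite Dt andbT; case/andP: Dt.
move=> s Us Ds sn; apply/allpairsPdep; exists (size s), s; split => //.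
  rewrite mem_iota /N -sn /= add0n ltnS.
  case/andP: Us => _; elim: (s) => //= x t IHt; rewrite inE negb_or => /andP[x0 /IHt]; lia.
by apply: distinct_parts_complete => //; rewrite sn /N.
Qed.
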